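(* Let $M$ and $N$ be Lie superalgebras over $\mathbb{K}$ acting on each other, and let $M\otimes N$ be their non-abelian tensor product. Then the canonical map $M\otimes_{\mathbb{K}}N\to M\otimes N$, $m\otimes n\mapsto m\otimes n$, is an even, surjective homomorphism of supermodules. In addition, if $M$ and $N$ act trivially on each other (i.e. ${}^mn=0$ and ${}^nm=0$ for all $m\in M$, $n\in N$), then $M\otimes N$ is an abelian Lie superalgebra (its bracket is zero) and there is an isomorphism of supermodules $$M\otimes N\cong M^{\mathrm{ab}}\otimes_{\mathbb{K}}N^{\mathrm{ab}},$$ where $M^{\mathrm{ab}}=M/[M,M]$ and $N^{\mathrm{ab}}=N/[N,N]$.
   Context: $\mathbb{K}$ is a unital commutative ring. A supermodule is a $\mathbb{K}$-module $M=M_{\bar0}\oplus M_{\bar1}$ graded by $\mathbb{Z}_2$; $|m|$ is the degree of a homogeneous element, and elements occurring in formulas with degrees are homogeneous. A linear map is even if it preserves degrees. The tensor product $M\otimes_{\mathbb{K}}N$ of supermodules is graded by $|m\otimes n|=|m|+|n|$. A Lie superalgebra is a supermodule $M$ with a bilinear bracket, $[M_{\alpha},M_{\beta}]\subseteq M_{\alpha+\beta}$, such that $[x,y]=-(-1)^{|x||y|}[y,x]$ and $[x,[y,z]]=[[x,y],z]+(-1)^{|x||y|}[y,[x,z]]$ for homogeneous $x,y,z$, and $[x,x]=0$ for $x\in M_{\bar0}$. An action of a Lie superalgebra $P$ on a Lie superalgebra $M$ is an even bilinear map $P\times M\to M$, $(p,m)\mapsto{}^pm$, with ${}^{[p,p']}m={}^p({}^{p'}m)-(-1)^{|p||p'|}\,{}^{p'}({}^pm)$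 and ${}^p[m,m']=[{}^pm,m']+(-1)^{|p||m|}[m,{}^pm']$. Non-abelian tensor product: for Lie superalgebras $M,N$ acting on each other, $M\otimes N$ is the Lie superalgebra generated by symbols $m\otimes n$ ($m\in M_{\bar0}\cup M_{\bar1}$, $n\in N_{\bar0}\cup N_{\bar1}$), of degree $|m|+|n|$, subject to: (i) $\lambda(m\otimes n)=\lambda m\otimes n=m\otimes\lambda n$ for $\lambda\in\mathbb{K}$; (ii) $(m+m')\otimes n=m\otimes n+m'\otimes n$ and $m\otimes(n+n')=m\otimes n+m\otimes n'$ for $m,m'$ (resp. $n,n'$) of the same degree; (iii) $[m,m']\otimes n=m\otimes{}^{m'}n-(-1)^{|m||m'|}(m'\otimes{}^mn)$ and $m\otimes[n,n']=(-1)^{|n'|(|m|+|n|)}({}^{n'}m\otimes n)-(-1)^{|m||n|}({}^nm\otimes n')$; (iv) $[m\otimes n,m'\otimes n']=-(-1)^{|m||n|}({}^nm\otimes{}^{m'}n')$. For non-homogeneous $m,n$ the symbol $m\otimes n$ is extended bilinearly. *)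

(* Defs.v *)
From HB Require Import structures.
From mathcomp Require Import all_boot all_algebra.
From mathcomp Require Import boolp.

Set Implicit Arguments.
Unset Strict Implicit.
Unset Printing Implicit Defensive.

Import GRing.Theory.

Local Open Scope ring_scope.
Local Open Scope quotient_scope.

(* [comPzRingType] (rather than [comNzRingType]) does not exclude the zero
   ring. The group Z_2 of degrees is [bool] with [addb], so that the sign
   (-1)^{|x||y|} of elements of degrees a and b is [(-1) ^+ (a && b)]. *)

Definition internal_direct_sum (K : comPzRingType) (V : lmodType K)
    (S : bool -> {pred V}) : Prop :=
  [/\ forall a, submod_closed (S a),
      forall x, exists x0 x1,
        [/\ x0 \in S false, x1 \in S true & x = x0 + x1]
    & forall x, x \in S false -> x \in S true -> x = 0].

HB.mixin Record isSuperModule (K : comPzRingType) V of GRing.Lmodule K V := {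
  grade : bool -> {pred V};
  gradeP : internal_direct_sum grade
}.

#[short(type="superModType")]
HB.structure Definition SuperModule (K : comPzRingType) :=
  {V of GRing.Lmodule K V & isSuperModule K V}.

HB.mixin Record isLieSuperAlgebra (K : comPzRingType) V
    of SuperModule K V := {
  bracket : V -> V -> V;
  bracket_linearl : forall y, linear (bracket^~ y);
  bracket_linearr : forall x, linear (bracket x);
  bracket_grade : forall a b x y, x \in grade a -> y \in grade b ->
    bracket x y \in grade (a (+) b);
  bracket_skew : forall a b x y, x \in grade a -> y \in grade b ->
    bracket x y = - ((-1) ^+ (a && b) *: bracket y x);
  bracket_jacobi : forall a b c x y z,
    x \in grade a -> y \in grade b -> z \in grade c ->
    bracket x (bracket y z) =
      bracket (bracket x y) z + (-1) ^+ (a && b) *: bracket y (bracket x z);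
  bracket_even : forall x, x \in grade false -> bracket x x = 0
}.

#[short(type="lieSuperAlgType")]
HB.structure Definition LieSuperAlgebra (K : comPzRingType) :=
  {V of SuperModule K V & isLieSuperAlgebra K V}.

Definition is_even (K : comPzRingType) (U V : superModType K) (f : U -> V) :=
  forall a x, x \in grade a -> f x \in grade a.

Record superAction (K : comPzRingType) (P M : lieSuperAlgType K) := SuperAction {
  act :> P -> M -> M;
  act_linearl : forall m, linear (act^~ m);
  act_linearr : forall p, linear (act p);
  act_grade : forall a b p m, p \in grade a -> m \in grade b ->
    act p m \in grade (a (+) b);
  act_bracketl : forall a b p p' m, p \in grade a -> p' \in grade b ->
    act (bracket p p') m =
      act p (act p' m) - (-1) ^+ (a && b) *: act p' (act p m);
  act_bracketr : forall a b p m m', p \in grade a -> m \in grade b ->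
    act p (bracket m m') =
      bracket (act p m) m' + (-1) ^+ (a && b) *: bracket m (act p m')
}.

Definition acts_trivially (K : comPzRingType) (P M : lieSuperAlgType K)
    (f : superAction P M) := forall p m, f p m = 0.

Definition is_abelian (K : comPzRingType) (M : lieSuperAlgType K) :=
  forall x y : M, bracket x y = 0.

Definition supermodule_iso (K : comPzRingType) (U V : superModType K) : Prop :=
  exists f : {linear U -> V}, is_even f /\ bijective f.

Section Components.
Variables (K : comPzRingType) (V : superModType K).

Lemma grade0 a : 0 \in @grade K V a.
Proof. by case: (@gradeP K V) => /(_ a)[]. Qed.

Lemma gradeDZ a k (x y : V) :
  x \in grade a -> y \in grade a -> k *: x + y \in grade a.
Proof. by case: (@gradeP K V) => /(_ a)[_ h] _ _; apply: h. Qed.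

Lemma gradeD a (x y : V) : x \in grade a -> y \in grade a -> x + y \in grade a.
Proof. by move=> xa ya; rewrite -[x]scale1r gradeDZ. Qed.

Lemma gradeZ a k (x : V) : x \in grade a -> k *: x \in grade a.
Proof. by move=> xa; rewrite -[_ *: _]addr0 gradeDZ ?grade0. Qed.

Lemma gradeN a (x : V) : x \in grade a -> - x \in grade a.
Proof. by move=> xa; rewrite -scaleN1r gradeZ. Qed.

Lemma component_ex (x : V) :
  exists y, (y \in grade false) && (x - y \in grade true).
Proof.
case: (@gradeP K V) => _ /(_ x)[x0 [x1 [h0 h1 ->]]] _.
by exists x0; rewrite h0 addrC addKr.
Qed.

Definition component (a : bool) (x : V) : V :=
  if a then x - xchoose (component_ex x) else xchoose (component_ex x).

Arguments component : simpl never.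

Lemma component_grade a x : component a x \in grade a.
Proof. by rewrite /component; case/andP: (xchooseP (component_ex x)); case: a. Qed.

Lemma component_sum x : component false x + component true x = x.
Proof. by rewrite /component addrC subrK. Qed.

Lemma component_unique (x x0 x1 : V) : x0 \in grade false -> x1 \in grade true ->
  x = x0 + x1 -> component false x = x0 /\ component true x = x1.
Proof.
move=> h0 h1 xE.
have e : component false x - x0 = x1 - component true x.
  apply/eqP; rewrite subr_eq addrAC -[_ == _]/(_ == _ - component true x).
  by rewrite eq_sym subr_eq component_sum addrC xE.
have z : component false x - x0 = 0.
  case: (@gradeP K V) => _ _; apply; first by rewrite gradeD ?gradeN ?component_grade.
  by rewrite e gradeD ?gradeN ?component_grade.
split; first by apply/eqP; rewrite -subr_eq0 z.
by apply/eqP; rewrite eq_sym -subr_eq0 -e z.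
Qed.

Lemma component_linear a : linear (component a).
Proof.
move=> k x y.
have [] := @component_unique (k *: x + y)
  (k *: component false x + component false y)
  (k *: component true x + component true y).
- by rewrite gradeDZ ?component_grade.
- by rewrite gradeDZ ?component_grade.
- by rewrite addrACA -scalerDr !component_sum.
by case: a.
Qed.

HB.instance Definition _ a :=
  GRing.isLinear.Build K V V *:%R (component a) (component_linear a).

Lemma component_id a x : x \in grade a -> component a x = x.
Proof.
case: a => xa.
  by have [] := component_unique (grade0 false) xa (esym (add0r x)).
by have [] := component_unique xa (grade0 true) (esym (addr0 x)).
Qed.

Lemma component_neq a x : x \in grade (~~ a) -> component a x = 0.
Proof.
case: a => /= xa.
  by have [] := component_unique xa (grade0 true) (esym (addr0 x)).
by have [] := component_unique (grade0 false) xa (esym (add0r x)).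
Qed.

End Components.

Arguments component {K V} a x : simpl never.

(* A K-module presented as a quotient of a type of terms by a congruence. *)

Record module_congruence (K : comPzRingType) (T : Type)
    (e : T -> T -> Prop) (zero : T) (add : T -> T -> T)
    (scale : K -> T -> T) : Prop := ModuleCongruence {
  mc_refl : forall s, e s s;
  mc_sym : forall s t, e s t -> e t s;
  mc_trans : forall s t u, e s t -> e t u -> e s u;
  mc_add : forall s s' t t', e s s' -> e t t' -> e (add s t) (add s' t');
  mc_scale : forall k s s', e s s' -> e (scale k s) (scale k s');
  mc_addA : forall s t u, e (add s (add t u)) (add (add s t) u);
  mc_addC : forall s t, e (add s t) (add t s);
  mc_add0 : forall s, e (add zero s) s;
  mc_scaleA : forall k l s, e (scale k (scale l s)) (scale (k * l) s);
  mc_scale0 : forall s, e (scale 0 s) zero;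
  mc_scale1 : forall s, e (scale 1 s) s;
  mc_scaleDr : forall k s t, e (scale k (add s t)) (add (scale k s) (scale k t));
  mc_scaleDl : forall k l s, e (scale (k + l) s) (add (scale k s) (scale l s))
}.

Record presentation (K : comPzRingType) := Presentation {
  pterm :> Type;
  prel : pterm -> pterm -> Prop;
  pzero : pterm;
  padd : pterm -> pterm -> pterm;
  pscale : K -> pterm -> pterm;
  pcong : module_congruence prel pzero padd pscale
}.

Section Presented.
Variables (K : comPzRingType) (P : presentation K).

Definition prelb : rel {classic P} := fun s t => `[< @prel K P s t >].

Lemma prelb_refl : reflexive prelb.
Proof. by move=> s; apply/asboolP; exact: mc_refl (pcong P) s. Qed.

Lemma prelb_sym : symmetric prelb.
Proof. by move=> s t; apply/asboolP/asboolP; exact: mc_sym (pcong P) _ _. Qed.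

Lemma prelb_trans : transitive prelb.
Proof.
move=> t s u /asboolP st /asboolP tu; apply/asboolP.
exact: mc_trans (pcong P) _ _ _ st tu.
Qed.

Canonical prelb_equiv := EquivRel prelb prelb_refl prelb_sym prelb_trans.

Definition presented : Type := {eq_quot prelb_equiv}.

HB.instance Definition _ := Choice.on presented.
HB.instance Definition _ := EqQuotient.on presented.

Definition cls (s : P) : presented := \pi_presented (s : {classic P}).

Lemma clsP s t : cls s = cls t <-> @prel K P s t.
Proof.
split=> [/eqP|st]; last by apply/eqP; rewrite eqmodE; apply/asboolP.
by rewrite eqmodE => /asboolP.
Qed.

Definition rep (x : presented) : P := repr x.

Lemma repK x : cls (rep x) = x. Proof. exact: reprK. Qed.

Lemma rep_cls s : @prel K P (rep (cls s)) s.
Proof. by apply/clsP; rewrite repK. Qed.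

Lemma cls_ind (Q : presented -> Prop) : (forall s, Q (cls s)) -> forall x, Q x.
Proof. by move=> h x; rewrite -[x]repK. Qed.

Definition add_presented (x y : presented) := cls (padd (rep x) (rep y)).
Definition scale_presented (k : K) (x : presented) := cls (pscale k (rep x)).

Lemma add_presentedE s t : add_presented (cls s) (cls t) = cls (padd s t).
Proof. by apply/clsP; apply: (mc_add (pcong P)); exact: rep_cls. Qed.

Lemma scale_presentedE k s : scale_presented k (cls s) = cls (pscale k s).
Proof. by apply/clsP; apply: (mc_scale (pcong P)); exact: rep_cls. Qed.

Let addA : associative add_presented.
Proof.
elim/cls_ind=> s; elim/cls_ind=> t; elim/cls_ind=> u; rewrite !add_presentedE.
by apply/clsP; exact: mc_addA (pcong P) _ _ _.
Qed.

Let addC : commutative add_presented.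
Proof.
elim/cls_ind=> s; elim/cls_ind=> t; rewrite !add_presentedE.
by apply/clsP; exact: mc_addC (pcong P) _ _.
Qed.

Let add0 : left_id (cls (pzero P)) add_presented.
Proof.
elim/cls_ind=> s; rewrite !add_presentedE.
by apply/clsP; exact: mc_add0 (pcong P) _.
Qed.

HB.instance Definition _ := GRing.isNmodule.Build presented addA addC add0.

Let scaleA k l x : scale_presented k (scale_presented l x)
  = scale_presented (k * l) x.
Proof.
elim/cls_ind: x => s; rewrite !scale_presentedE.
by apply/clsP; exact: mc_scaleA (pcong P) _ _ _.
Qed.

Let scale0 x : scale_presented 0 x = 0.
Proof.
elim/cls_ind: x => s; rewrite !scale_presentedE.
by apply/clsP; exact: mc_scale0 (pcong P) _.
Qed.

Let scale1 : left_id 1 scale_presented.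
Proof.
elim/cls_ind=> s; rewrite !scale_presentedE.
by apply/clsP; exact: mc_scale1 (pcong P) _.
Qed.

Let scaleDr : right_distributive scale_presented +%R.
Proof.
move=> k; elim/cls_ind=> s; elim/cls_ind=> t.
rewrite [cls s + _]add_presentedE !scale_presentedE [RHS]add_presentedE.
by apply/clsP; exact: mc_scaleDr (pcong P) _ _ _.
Qed.

Let scaleDl x : {morph scale_presented^~ x : k l / k + l}.
Proof.
move=> k l; elim/cls_ind: x => s; rewrite !scale_presentedE [RHS]add_presentedE.
by apply/clsP; exact: mc_scaleDl (pcong P) _ _ _.
Qed.

HB.instance Definition _ := GRing.Nmodule_isLSemiModule.Build K presented
  scaleA scale0 scale1 scaleDr scaleDl.
HB.instance Definition _ := GRing.LSemiModule_isLmodule.Build K presented.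

Lemma cls0 : cls (pzero P) = 0. Proof. by []. Qed.

Lemma clsD s t : cls (padd s t) = cls s + cls t.
Proof. by rewrite -add_presentedE. Qed.

Lemma clsZ k s : cls (pscale k s) = k *: cls s.
Proof. by rewrite -scale_presentedE. Qed.

Lemma lift_cls (U : Type) (f : P -> U) :
  (forall s t, prel s t -> f s = f t) -> forall s, f (rep (cls s)) = f s.
Proof. by move=> h s; apply/h/rep_cls. Qed.

End Presented.

Lemma internal_direct_sum_proj (K : comPzRingType) (V : lmodType K)
    (S : bool -> {pred V}) (p : bool -> V -> V) :
    (forall a, submod_closed (S a)) -> (forall a x, p a x \in S a) ->
    (forall x, p false x + p true x = x) ->
    (forall a x, x \in S (~~ a) -> p a x = 0) ->
  internal_direct_sum S.
Proof.
move=> Ssub pS psum p0; split=> // [x|x x0 x1].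
  by exists (p false x), (p true x); rewrite !pS psum.
by rewrite -[x]psum (p0 false) // (p0 true) // addr0.
Qed.

Section Span.
Variables (K : comPzRingType) (V : lmodType K) (X : V -> Prop).

Inductive span : V -> Prop :=
| span_mem x of X x : span x
| span0 : span 0
| spanD x y of span x & span y : span (x + y)
| spanZ k x of span x : span (k *: x).

Lemma span_submod (S : {pred V}) : S =i (fun x => `[< span x >]) ->
  submod_closed S.
Proof.
move=> SE; split; first by rewrite SE; apply/asboolP; exact: span0.
move=> k x y; rewrite !SE => /asboolP xS /asboolP yS; apply/asboolP.
by apply: spanD => //; exact: spanZ.
Qed.

Lemma span_sub (S : {pred V}) : submod_closed S ->
  (forall x, X x -> x \in S) -> forall x, span x -> x \in S.
Proof.
move=> [S0 SDZ] XS x; elim=> {x} [||x y _ xS _ yS|k x _ xS] //.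
  by rewrite -[x]scale1r SDZ.
by rewrite -[_ *: _]addr0 SDZ.
Qed.

Definition quotient_rel (x y : V) : Prop := span (x - y).

Lemma quotient_congruence :
  @module_congruence K V quotient_rel 0 +%R *:%R.
Proof.
rewrite /quotient_rel; split.
- by move=> s; rewrite subrr; exact: span0.
- by move=> s t /(spanZ (-1)); rewrite scaleN1r opprB.
- by move=> s t u st /(spanD st); rewrite addrA subrK.
- by move=> s s' t t' ss tt; rewrite opprD addrACA; exact: spanD.
- by move=> k s s' ss; rewrite -scalerBr; exact: spanZ.
- by move=> s t u; rewrite addrA subrr; exact: span0.
- by move=> s t; rewrite [s + t]addrC subrr; exact: span0.
- by move=> s; rewrite add0r subrr; exact: span0.
- by move=> k l s; rewrite scalerA subrr; exact: span0.
- by move=> s; rewrite scale0r subrr; exact: span0.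
- by move=> s; rewrite scale1r subrr; exact: span0.
- by move=> k s t; rewrite scalerDr subrr; exact: span0.
- by move=> k l s; rewrite scalerDl subrr; exact: span0.
Qed.

Definition quotient_presentation : presentation K :=
  Presentation quotient_congruence.

End Span.

(* M^ab = M / [M, M], with [M, M] the submodule spanned by the brackets. *)
Section Abelianization.
Variables (K : comPzRingType) (M : lieSuperAlgType K).

Definition is_bracket (z : M) : Prop := exists x y : M, z = bracket x y.

Definition abelianization : Type := presented (quotient_presentation is_bracket).

HB.instance Definition _ := GRing.Lmodule.on abelianization.

Definition to_ab (x : M) : abelianization :=
  cls (x : quotient_presentation is_bracket).

Lemma to_ab_linear : linear to_ab.
Proof.
move=> k x y.
rewrite -[k *: to_ab x](clsZ (P := quotient_presentation is_bracket)).
by rewrite -[RHS](clsD (P := quotient_presentation is_bracket)).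
Qed.

HB.instance Definition _ :=
  GRing.isLinear.Build K M abelianization *:%R to_ab to_ab_linear.

Lemma to_abP x y : to_ab x = to_ab y <-> span is_bracket (x - y).
Proof. exact: (clsP (P := quotient_presentation is_bracket)). Qed.

Lemma to_ab_ind (Q : abelianization -> Prop) :
  (forall x, Q (to_ab x)) -> forall y, Q y.
Proof. exact: (cls_ind (P := quotient_presentation is_bracket)). Qed.

Definition ab_grade (a : bool) : {pred abelianization} :=
  fun y => `[< exists2 x : M, x \in grade a & y = to_ab x >].

Lemma ab_gradeP a y :
  reflect (exists2 x : M, x \in grade a & y = to_ab x) (y \in ab_grade a).
Proof. exact: asboolP. Qed.

Lemma component_bracket (x y : M) a : component a (bracket x y) =
  bracket (component false x) (component a y) +
  bracket (component true x) (component (~~ a) y).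
Proof.
have Dl (u v w : M) : bracket (u + v) w = bracket u w + bracket v w.
  by have := @bracket_linearl K M w 1 u v; rewrite !scale1r.
have Dr (u v w : M) : bracket w (u + v) = bracket w u + bracket w v.
  by have := @bracket_linearr K M w 1 u v; rewrite !scale1r.
have H b c : bracket (component b x) (component c y) \in grade (b (+) c).
  by apply: bracket_grade; exact: component_grade.
have E : bracket x y = (bracket (component false x) (component false y) +
     bracket (component true x) (component true y)) +
   (bracket (component false x) (component true y) +
     bracket (component true x) (component false y)).
  rewrite -[in LHS](component_sum x) -[in LHS](component_sum y) Dl !(Dr (component false y) (component true y)).
  by rewrite [X in _ + X = _]addrC addrACA.
have [e0 e1] := component_unique
   (gradeD (H false false) (H true true)) (gradeD (H false true) (H true false)) E.
by case: a.
Qed.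

Lemma derived_graded a (z : M) :
  span is_bracket z -> span is_bracket (component a z).
Proof.
elim=> {z} [_ [x [y ->]]||x y _ hx _ hy|k x _ hx].
- by rewrite component_bracket; apply: spanD; apply: span_mem; do 2 eexists.
- by rewrite linear0; exact: span0.
- by rewrite linearD; exact: spanD.
- by rewrite linearZ; exact: spanZ.
Qed.

Lemma ab_direct_sum : internal_direct_sum ab_grade.
Proof.
split=> [a|y|y].
- split; first by apply/ab_gradeP; exists 0; rewrite ?grade0 ?linear0.
  move=> k x y /ab_gradeP[u ua ->] /ab_gradeP[v va ->]; apply/ab_gradeP.
  by exists (k *: u + v); rewrite ?gradeDZ // linearP.
- elim/to_ab_ind: y => x.
  exists (to_ab (component false x)), (to_ab (component true x)).
  split; last by rewrite -linearD component_sum.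
    by apply/ab_gradeP; exists (component false x); rewrite ?component_grade.
  by apply/ab_gradeP; exists (component true x); rewrite ?component_grade.
- move=> /ab_gradeP[u u0 ->] /ab_gradeP[v v1] /to_abP /(derived_graded false).
  rewrite linearB /= (component_id u0) (component_neq (a := false) v1) => h.
  by rewrite -[RHS](linear0 to_ab); apply/to_abP.
Qed.

HB.instance Definition _ :=
  isSuperModule.Build K abelianization ab_direct_sum.

End Abelianization.

Section Tensor.
Variables (K : comPzRingType) (M N : superModType K).

Inductive tterm : Type :=
| Tpure of M & N
| Tzero
| Tadd of tterm & tterm
| Tscale of K & tterm.

Inductive trel : tterm -> tterm -> Prop :=
| trel_refl s : trel s s
| trel_sym s t of trel s t : trel t s
| trel_trans s t u of trel s t & trel t u : trel s u
| trel_add s s' t t' of trel s s' & trel t t' : trel (Tadd s t) (Tadd s' t')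
| trel_scale k s s' of trel s s' : trel (Tscale k s) (Tscale k s')
| trel_addA s t u : trel (Tadd s (Tadd t u)) (Tadd (Tadd s t) u)
| trel_addC s t : trel (Tadd s t) (Tadd t s)
| trel_add0 s : trel (Tadd Tzero s) s
| trel_scaleA k l s : trel (Tscale k (Tscale l s)) (Tscale (k * l) s)
| trel_scale0 s : trel (Tscale 0 s) Tzero
| trel_scale1 s : trel (Tscale 1 s) s
| trel_scaleDr k s t :
    trel (Tscale k (Tadd s t)) (Tadd (Tscale k s) (Tscale k t))
| trel_scaleDl k l s : trel (Tscale (k + l) s) (Tadd (Tscale k s) (Tscale l s))
| trel_pureDl m m' n : trel (Tpure (m + m') n) (Tadd (Tpure m n) (Tpure m' n))
| trel_pureDr m n n' : trel (Tpure m (n + n')) (Tadd (Tpure m n) (Tpure m n'))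
| trel_pureZl k m n : trel (Tpure (k *: m) n) (Tscale k (Tpure m n))
| trel_pureZr k m n : trel (Tpure m (k *: n)) (Tscale k (Tpure m n)).

Lemma trel_congruence : module_congruence trel Tzero Tadd Tscale.
Proof.
split; [exact: trel_refl|exact: trel_sym|exact: trel_trans|exact: trel_add
 |exact: trel_scale|exact: trel_addA|exact: trel_addC|exact: trel_add0
 |exact: trel_scaleA|exact: trel_scale0|exact: trel_scale1|exact: trel_scaleDr
 |exact: trel_scaleDl].
Qed.

Definition tensor_presentation : presentation K := Presentation trel_congruence.

Definition tensor : Type := presented tensor_presentation.

HB.instance Definition _ := GRing.Lmodule.on tensor.

Definition tens (m : M) (n : N) : tensor :=
  cls (Tpure m n : tensor_presentation).

Lemma tensDl m m' n : tens (m + m') n = tens m n + tens m' n.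
Proof.
rewrite -[RHS](clsD (P := tensor_presentation)); apply/clsP.
exact: trel_pureDl.
Qed.

Lemma tensDr m n n' : tens m (n + n') = tens m n + tens m n'.
Proof.
rewrite -[RHS](clsD (P := tensor_presentation)); apply/clsP.
exact: trel_pureDr.
Qed.

Lemma tensZl k m n : tens (k *: m) n = k *: tens m n.
Proof.
rewrite -[RHS](clsZ (P := tensor_presentation)); apply/clsP.
exact: trel_pureZl.
Qed.

Lemma tensZr k m n : tens m (k *: n) = k *: tens m n.
Proof.
rewrite -[RHS](clsZ (P := tensor_presentation)); apply/clsP.
exact: trel_pureZr.
Qed.

Lemma tens_linearl n : linear (tens^~ n).
Proof. by move=> k x y; rewrite tensDl tensZl. Qed.

Lemma tens_linearr m : linear (tens m).
Proof. by move=> k x y; rewrite tensDr tensZr. Qed.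

Lemma tensor_ind (Q : tensor -> Prop) : Q 0 ->
  (forall x y, Q x -> Q y -> Q (x + y)) -> (forall k x, Q x -> Q (k *: x)) ->
  (forall m n, Q (tens m n)) -> forall x, Q x.
Proof.
move=> Q0 QD QZ Qt; apply: (cls_ind (P := tensor_presentation)).
elim=> [m n||s hs t ht|k s hs]; first exact: Qt.
- exact: Q0.
- by rewrite clsD; exact: QD.
- by rewrite clsZ; exact: QZ.
Qed.

Section Lift.
Variables (W : lmodType K) (f : M -> N -> W).
Hypotheses (fl : forall n, linear (f^~ n)) (fr : forall m, linear (f m)).

Fixpoint tensor_eval (t : tterm) : W :=
  match t with
  | Tpure m n => f m n
  | Tzero => 0
  | Tadd s t => tensor_eval s + tensor_eval t
  | Tscale k s => k *: tensor_eval s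
  end.

Lemma tensor_evalP s t : trel s t -> tensor_eval s = tensor_eval t.
Proof.
have f0l n : f 0 n = 0 by have := fl n (-1) 0 0; rewrite scaleN1r oppr0 addr0 scaleN1r addNr.
have f0r m : f m 0 = 0 by have := fr m (-1) 0 0; rewrite scaleN1r oppr0 addr0 scaleN1r addNr.
elim=> {s t} //=.
- by move=> s t u _ -> _ ->.
- by move=> s s' t t' _ -> _ ->.
- by move=> k s s' _ ->.
- by move=> s t u; rewrite addrA.
- by move=> s t; rewrite addrC.
- by move=> s; rewrite add0r.
- by move=> k l s; rewrite scalerA.
- by move=> s; rewrite scale0r.
- by move=> s; rewrite scale1r.
- by move=> k s t; rewrite scalerDr.
- by move=> k l s; rewrite scalerDl.
- by move=> m m' n; have := fl n 1 m m'; rewrite !scale1r.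
- by move=> m n n'; have := fr m 1 n n'; rewrite !scale1r.
- by move=> k m n; have := fl n k m 0; rewrite !addr0 f0l addr0.
- by move=> k m n; have := fr m k n 0; rewrite !addr0 f0r addr0.
Qed.

Definition tensor_lift (x : tensor) : W := tensor_eval (rep x).

Lemma tensor_lift_tens m n : tensor_lift (tens m n) = f m n.
Proof. exact: (lift_cls (P := tensor_presentation) tensor_evalP). Qed.

Lemma tensor_lift_linear : linear tensor_lift.
Proof.
move=> k; apply: (cls_ind (P := tensor_presentation)) => s.
apply: (cls_ind (P := tensor_presentation)) => t.
rewrite -[k *: _](clsZ (P := tensor_presentation)).
rewrite -[_ + _](clsD (P := tensor_presentation)).
by rewrite /tensor_lift !(lift_cls (P := tensor_presentation) tensor_evalP).
Qed.

End Lift.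

Definition pure_of_degree (d : bool) (x : tensor) : Prop :=
  exists a b m n,
    [/\ a (+) b = d, m \in grade a, n \in grade b & x = tens m n].

Definition tensor_grade (d : bool) : {pred tensor} :=
  fun x => `[< span (pure_of_degree d) x >].

Lemma tensor_gradeP d x :
  reflect (span (pure_of_degree d) x) (x \in tensor_grade d).
Proof. exact: asboolP. Qed.

Lemma tensor_grade_closed d : submod_closed (tensor_grade d).
Proof. exact: (@span_submod _ _ (pure_of_degree d)). Qed.

Lemma tens_grade a b m n : m \in grade a -> n \in grade b ->
  tens m n \in tensor_grade (a (+) b).
Proof.
by move=> ma nb; apply/tensor_gradeP/span_mem; exists a, b, m, n; split.
Qed.

Let proj_fun d m n : tensor := tens (component false m) (component d n) +
  tens (component true m) (component (~~ d) n).

Let proj_funl d n : linear ((proj_fun d)^~ n).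
Proof.
by move=> k x y; rewrite /proj_fun !component_linear !tens_linearl scalerDr addrACA.
Qed.

Let proj_funr d m : linear (proj_fun d m).
Proof.
by move=> k x y; rewrite /proj_fun !component_linear !tens_linearr scalerDr addrACA.
Qed.

Let proj d := tensor_lift (proj_fun d).

Let projl d k x y : proj d (k *: x + y) = k *: proj d x + proj d y.
Proof. exact: (tensor_lift_linear (proj_funl d) (proj_funr d)). Qed.

Let proj0 d : proj d 0 = 0.
Proof. by have := projl d (-1) 0 0; rewrite scaleN1r oppr0 addr0 scaleN1r addNr. Qed.

Let projD d x y : proj d (x + y) = proj d x + proj d y.
Proof. by have := projl d 1 x y; rewrite !scale1r. Qed.

Let projZ d k x : proj d (k *: x) = k *: proj d x.
Proof. by have := projl d k x 0; rewrite !addr0 proj0 addr0. Qed.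

Let projt d m n : proj d (tens m n) = proj_fun d m n.
Proof. exact: (tensor_lift_tens (proj_funl d) (proj_funr d)). Qed.

Lemma tensor_direct_sum : internal_direct_sum tensor_grade.
Proof.
have t0l n : tens 0 n = 0 by rewrite -(scale0r 0) tensZl scale0r.
have t0r m : tens m 0 = 0 by rewrite -(scale0r 0) tensZr scale0r.
apply: (@internal_direct_sum_proj _ _ _ proj) => [|d x|x|d x].
- exact: tensor_grade_closed.
- have [S0 Sl] := tensor_grade_closed d.
  have SD u v : u \in tensor_grade d -> v \in tensor_grade d ->
      u + v \in tensor_grade d by move=> hu hv; rewrite -[u]scale1r Sl.
  elim/tensor_ind: x => [|x y hx hy|k x hx|m n]; first by rewrite proj0.
  + by rewrite projD SD.
  + by rewrite projZ -[_ *: _]addr0 Sl.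
  rewrite projt; apply: SD.
    by have := tens_grade (component_grade false m) (component_grade d n).
  by have := tens_grade (component_grade true m) (component_grade (~~ d) n);
    rewrite addTb negbK.
- elim/tensor_ind: x => [|x y hx hy|k x hx|m n]; first by rewrite !proj0 addr0.
  + by rewrite !projD addrACA hx hy.
  + by rewrite !projZ -scalerDr hx.
  rewrite !projt /proj_fun /= addrACA -!tensDr.
  by rewrite [component true n + _]addrC component_sum -tensDl component_sum.
- move/tensor_gradeP; elim=> {x} [x||x y _ hx _ hy|k x _ hx].
  + move=> [a [b [m [n [dE ma nb ->]]]]]; rewrite projt /proj_fun.
    case: a dE ma => dE ma.
      rewrite (component_neq (a := false) ma) t0l add0r.
      by rewrite (component_neq (a := ~~ d)) ?t0r // -dE addTb negbK.
    rewrite (component_neq (a := true) ma) t0l addr0.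
    by rewrite (component_neq (a := d)) ?t0r // -dE addFb.
  + exact: proj0.
  + by rewrite projD hx hy addr0.
  + by rewrite projZ hx scaler0.
Qed.

HB.instance Definition _ := isSuperModule.Build K tensor tensor_direct_sum.

End Tensor.

Section BracketTheory.
Variables (K : comPzRingType) (M : lieSuperAlgType K).
Implicit Types x y z : M.

Lemma bracketDl x y z : bracket (x + y) z = bracket x z + bracket y z.
Proof. by have := @bracket_linearl K M z 1 x y; rewrite !scale1r. Qed.

Lemma bracketDr x y z : bracket x (y + z) = bracket x y + bracket x z.
Proof. by have := @bracket_linearr K M x 1 y z; rewrite !scale1r. Qed.

Lemma bracket0l y : bracket (0 : M) y = 0.
Proof.
by have := @bracket_linearl K M y (-1) 0 0;
  rewrite scaleN1r oppr0 addr0 scaleN1r addNr.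
Qed.

Lemma bracket0r x : bracket x (0 : M) = 0.
Proof.
by have := @bracket_linearr K M x (-1) 0 0;
  rewrite scaleN1r oppr0 addr0 scaleN1r addNr.
Qed.

Lemma bracketZl k x y : bracket (k *: x) y = k *: bracket x y.
Proof.
by have := @bracket_linearl K M y k x 0; rewrite !addr0 bracket0l addr0.
Qed.

Lemma bracketZr k x y : bracket x (k *: y) = k *: bracket x y.
Proof.
by have := @bracket_linearr K M x k y 0; rewrite !addr0 bracket0r addr0.
Qed.

End BracketTheory.

Section NonAbelianTensor.
Variables (K : comPzRingType) (M N : lieSuperAlgType K).
Variables (f : superAction M N) (g : superAction N M).

(* [Ngen] is the symbol m (x) n; as 0 has both degrees, the degrees a and b of
   m and n are part of the symbol. The symbols involving 0 all vanish, see
   [ncls_gen0l] and [ncls_gen0r]. *)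
Inductive nterm : Type :=
| Ngen a b (m : M) (n : N) of m \in grade a & n \in grade b
| Nzero
| Nadd of nterm & nterm
| Nscale of K & nterm
| Nbracket of nterm & nterm.

Inductive nhomog : bool -> nterm -> Prop :=
| nhomog_gen a b m n (ma : m \in grade a) (nb : n \in grade b) :
    nhomog (a (+) b) (Ngen ma nb)
| nhomog_zero a : nhomog a Nzero
| nhomog_add a s t of nhomog a s & nhomog a t : nhomog a (Nadd s t)
| nhomog_scale a k s of nhomog a s : nhomog a (Nscale k s)
| nhomog_bracket a b s t of nhomog a s & nhomog b t :
    nhomog (a (+) b) (Nbracket s t).

Definition Nopp (s : nterm) := Nscale (-1) s.
Definition Nsign (b : bool) (s : nterm) := Nscale ((-1) ^+ b) s.

(* The least congruence imposing the axioms of a Lie superalgebra (up to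
   [nrel_even]) and the defining relations between the symbols (from
   [nrel_genZl] on). The proofs that the arguments of the symbols are
   homogeneous are universally quantified; they always exist. *)
Inductive nrel : nterm -> nterm -> Prop :=
| nrel_refl s : nrel s s
| nrel_sym s t of nrel s t : nrel t s
| nrel_trans s t u of nrel s t & nrel t u : nrel s u
| nrel_add s s' t t' of nrel s s' & nrel t t' : nrel (Nadd s t) (Nadd s' t')
| nrel_scale k s s' of nrel s s' : nrel (Nscale k s) (Nscale k s')
| nrel_bracket s s' t t' of nrel s s' & nrel t t' :
    nrel (Nbracket s t) (Nbracket s' t')
| nrel_addA s t u : nrel (Nadd s (Nadd t u)) (Nadd (Nadd s t) u)
| nrel_addC s t : nrel (Nadd s t) (Nadd t s)
| nrel_add0 s : nrel (Nadd Nzero s) s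
| nrel_scaleA k l s : nrel (Nscale k (Nscale l s)) (Nscale (k * l) s)
| nrel_scale0 s : nrel (Nscale 0 s) Nzero
| nrel_scale1 s : nrel (Nscale 1 s) s
| nrel_scaleDr k s t :
    nrel (Nscale k (Nadd s t)) (Nadd (Nscale k s) (Nscale k t))
| nrel_scaleDl k l s : nrel (Nscale (k + l) s) (Nadd (Nscale k s) (Nscale l s))
| nrel_bracketDl s t u :
    nrel (Nbracket (Nadd s t) u) (Nadd (Nbracket s u) (Nbracket t u))
| nrel_bracketDr s t u :
    nrel (Nbracket s (Nadd t u)) (Nadd (Nbracket s t) (Nbracket s u))
| nrel_bracketZl k s t : nrel (Nbracket (Nscale k s) t) (Nscale k (Nbracket s t))
| nrel_bracketZr k s t : nrel (Nbracket s (Nscale k t)) (Nscale k (Nbracket s t))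
| nrel_skew a b s t of nhomog a s & nhomog b t :
    nrel (Nbracket s t) (Nopp (Nsign (a && b) (Nbracket t s)))
| nrel_jacobi a b c s t u of nhomog a s & nhomog b t & nhomog c u :
    nrel (Nbracket s (Nbracket t u))
      (Nadd (Nbracket (Nbracket s t) u)
         (Nsign (a && b) (Nbracket t (Nbracket s u))))
| nrel_even s of nhomog false s : nrel (Nbracket s s) Nzero
| nrel_genZl k a b m n (ma : m \in grade a) (nb : n \in grade b)
    (kma : k *: m \in grade a) :
    nrel (Nscale k (Ngen ma nb)) (Ngen kma nb)
| nrel_genZr k a b m n (ma : m \in grade a) (nb : n \in grade b)
    (knb : k *: n \in grade b) :
    nrel (Nscale k (Ngen ma nb)) (Ngen ma knb)
| nrel_genDl a b m m' n (ma : m \in grade a) (ma' : m' \in grade a)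
    (nb : n \in grade b) (mma : m + m' \in grade a) :
    nrel (Ngen mma nb) (Nadd (Ngen ma nb) (Ngen ma' nb))
| nrel_genDr a b m n n' (ma : m \in grade a) (nb : n \in grade b)
    (nb' : n' \in grade b) (nnb : n + n' \in grade b) :
    nrel (Ngen ma nnb) (Nadd (Ngen ma nb) (Ngen ma nb'))
| nrel_gen_bracketl a a' b m m' n (ma : m \in grade a) (ma' : m' \in grade a')
    (mm' : bracket m m' \in grade (a (+) a')) (nb : n \in grade b)
    (m'n : f m' n \in grade (a' (+) b)) (mn : f m n \in grade (a (+) b)) :
    nrel (Ngen mm' nb)
      (Nadd (Ngen ma m'n) (Nopp (Nsign (a && a') (Ngen ma' mn))))
| nrel_gen_bracketr a b b' m n n' (ma : m \in grade a) (nb : n \in grade b)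
    (nb' : n' \in grade b') (nn' : bracket n n' \in grade (b (+) b'))
    (n'm : g n' m \in grade (b' (+) a)) (nm : g n m \in grade (b (+) a)) :
    nrel (Ngen ma nn')
      (Nadd (Nsign (b' && (a (+) b)) (Ngen n'm nb))
         (Nopp (Nsign (a && b) (Ngen nm nb'))))
| nrel_gen_gen a b a' b' m n m' n' (ma : m \in grade a) (nb : n \in grade b)
    (ma' : m' \in grade a') (nb' : n' \in grade b')
    (nm : g n m \in grade (b (+) a)) (m'n' : f m' n' \in grade (a' (+) b')) :
    nrel (Nbracket (Ngen ma nb) (Ngen ma' nb'))
      (Nopp (Nsign (a && b) (Ngen nm m'n'))).

Lemma nrel_congruence : module_congruence nrel Nzero Nadd Nscale.
Proof.
split; [exact: nrel_refl|exact: nrel_sym|exact: nrel_trans|exact: nrel_add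
 |exact: nrel_scale|exact: nrel_addA|exact: nrel_addC|exact: nrel_add0
 |exact: nrel_scaleA|exact: nrel_scale0|exact: nrel_scale1|exact: nrel_scaleDr
 |exact: nrel_scaleDl].
Qed.

Definition natensor_presentation : presentation K :=
  Presentation nrel_congruence.

Definition natensor : Type := presented natensor_presentation.

HB.instance Definition _ := GRing.Lmodule.on natensor.

Definition ncls (s : nterm) : natensor := cls (s : natensor_presentation).

Lemma nclsP s t : ncls s = ncls t <-> nrel s t.
Proof. exact: (clsP (P := natensor_presentation)). Qed.

Lemma ncls_ind (Q : natensor -> Prop) : (forall s, Q (ncls s)) -> forall x, Q x.
Proof. exact: (cls_ind (P := natensor_presentation)). Qed.

Lemma ncls0 : ncls Nzero = 0. Proof. by []. Qed.

Lemma nclsD s t : ncls (Nadd s t) = ncls s + ncls t.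
Proof. exact: (clsD (P := natensor_presentation)). Qed.

Lemma nclsZ k s : ncls (Nscale k s) = k *: ncls s.
Proof. exact: (clsZ (P := natensor_presentation)). Qed.

Lemma nclsN s : ncls (Nopp s) = - ncls s.
Proof. by rewrite nclsZ scaleN1r. Qed.

Definition nbracket (x y : natensor) : natensor :=
  ncls (Nbracket (rep x) (rep y)).

Lemma nbracketE s t : nbracket (ncls s) (ncls t) = ncls (Nbracket s t).
Proof.
by apply/nclsP; apply: nrel_bracket;
  exact: (rep_cls (P := natensor_presentation)).
Qed.

Lemma nbracket_linearl y : linear (nbracket^~ y).
Proof.
move=> k; elim/ncls_ind=> s; elim/ncls_ind=> t; elim/ncls_ind: y => u.
rewrite -nclsZ -nclsD !nbracketE -nclsZ -nclsD; apply/nclsP.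
apply: nrel_trans (nrel_bracketDl _ _ _) _; apply: nrel_add (nrel_refl _).
exact: nrel_bracketZl.
Qed.

Lemma nbracket_linearr x : linear (nbracket x).
Proof.
move=> k; elim/ncls_ind=> s; elim/ncls_ind=> t; elim/ncls_ind: x => u.
rewrite -nclsZ -nclsD !nbracketE -nclsZ -nclsD; apply/nclsP.
apply: nrel_trans (nrel_bracketDr _ _ _) _; apply: nrel_add (nrel_refl _).
exact: nrel_bracketZr.
Qed.

Definition natensor_grade (d : bool) : {pred natensor} :=
  fun x => `[< exists2 s, nhomog d s & x = ncls s >].

Lemma natensor_gradeP d x :
  reflect (exists2 s, nhomog d s & x = ncls s) (x \in natensor_grade d).
Proof. exact: asboolP. Qed.

Lemma natensor_grade_closed d : submod_closed (natensor_grade d).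
Proof.
split; first by apply/natensor_gradeP; exists Nzero; first exact: nhomog_zero.
move=> k x y /natensor_gradeP[s sd ->] /natensor_gradeP[t td ->].
apply/natensor_gradeP; exists (Nadd (Nscale k s) t); last by rewrite nclsD nclsZ.
by apply: nhomog_add => //; exact: nhomog_scale.
Qed.

Let brDl x y z : nbracket (x + y) z = nbracket x z + nbracket y z.
Proof. by have := nbracket_linearl z 1 x y; rewrite !scale1r. Qed.

Let brDr x y z : nbracket x (y + z) = nbracket x y + nbracket x z.
Proof. by have := nbracket_linearr x 1 y z; rewrite !scale1r. Qed.

Let br0l y : nbracket 0 y = 0.
Proof.
by have := nbracket_linearl y (-1) 0 0;
  rewrite scaleN1r oppr0 addr0 scaleN1r addNr.
Qed.

Let br0r x : nbracket x 0 = 0.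
Proof.
by have := nbracket_linearr x (-1) 0 0;
  rewrite scaleN1r oppr0 addr0 scaleN1r addNr.
Qed.

Let brZl k x y : nbracket (k *: x) y = k *: nbracket x y.
Proof. by have := nbracket_linearl y k x 0; rewrite !addr0 br0l addr0. Qed.

Let brZr k x y : nbracket x (k *: y) = k *: nbracket x y.
Proof. by have := nbracket_linearr x k y 0; rewrite !addr0 br0r addr0. Qed.

Fixpoint nproj (d : bool) (s : nterm) : natensor :=
  match s with
  | Ngen a b m n ma nb => if a (+) b == d then ncls (Ngen ma nb) else 0
  | Nzero => 0
  | Nadd s t => nproj d s + nproj d t
  | Nscale k s => k *: nproj d s
  | Nbracket s t => nbracket (nproj false s) (nproj d t) +
                    nbracket (nproj true s) (nproj (~~ d) t)
  end.

Lemma nproj_homog a s : nhomog a s ->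
  forall d, nproj d s = if a == d then ncls s else 0.
Proof.
elim=> {a s} [a b m n ma nb|a|a s t _ hs _ ht|a k s _ hs|a b s t _ hs _ ht] d //=.
- by rewrite if_same.
- by rewrite hs ht; case: ifP => _; rewrite ?addr0 ?nclsD.
- by rewrite hs; case: ifP => _; rewrite ?scaler0 ?nclsZ.
- rewrite !hs !ht -nbracketE.
  by case: a b d {hs ht} => [] [] [] /=; rewrite ?br0l ?br0r ?addr0 ?add0r.
Qed.

Lemma nproj_eq_homog a s t : nhomog a s -> nhomog a t -> nrel s t ->
  forall d, nproj d s = nproj d t.
Proof.
by move=> sa ta /nclsP st d; rewrite (nproj_homog sa) (nproj_homog ta) st.
Qed.

Lemma nhomog_eq a b s : nhomog a s -> a = b -> nhomog b s.
Proof. by move=> h <-. Qed.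

Lemma nproj_nrel s t : nrel s t -> forall d, nproj d s = nproj d t.
Proof.
elim=> {s t}.
- by [].
- by [].
- by move=> s t u _ h1 _ h2 d /=; rewrite h1.
- by move=> s s' t t' _ h1 _ h2 d /=; rewrite h1 h2.
- by move=> k s s' _ h d /=; rewrite h.
- by move=> s s' t t' _ h1 _ h2 d /=; rewrite !h1 !h2.
- by move=> s t u d /=; rewrite addrA.
- by move=> s t d /=; rewrite addrC.
- by move=> s d /=; rewrite add0r.
- by move=> k l s d /=; rewrite scalerA.
- by move=> s d /=; rewrite scale0r.
- by move=> s d /=; rewrite scale1r.
- by move=> k s t d /=; rewrite scalerDr.
- by move=> k l s d /=; rewrite scalerDl.
- by move=> s t u d /=; rewrite !brDl addrACA.
- by move=> s t u d /=; rewrite !brDr addrACA.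
- by move=> k s t d /=; rewrite !brZl scalerDr.
- by move=> k s t d /=; rewrite !brZr scalerDr.
- move=> a b s t sa tb.
  apply: (@nproj_eq_homog (a (+) b)); last exact: nrel_skew.
    exact: nhomog_bracket.
  by do 2 apply: nhomog_scale; rewrite addbC; exact: nhomog_bracket.
- move=> a b c s t u sa tb uc.
  apply: (@nproj_eq_homog (a (+) (b (+) c))); last exact: (nrel_jacobi sa tb uc).
    by do 2?apply: nhomog_bracket.
  apply: nhomog_add; first by rewrite addbA; do 2?apply: nhomog_bracket.
  by apply: nhomog_scale; rewrite addbCA; do 2?apply: nhomog_bracket.
- move=> s s0; apply: (@nproj_eq_homog false); last exact: nrel_even.
    exact: (nhomog_bracket s0 s0).
  exact: nhomog_zero.
- move=> k a b m n ma nb kma; apply: (@nproj_eq_homog (a (+) b)).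
  + by apply: nhomog_scale; exact: nhomog_gen.
  + exact: nhomog_gen.
  + exact: nrel_genZl.
- move=> k a b m n ma nb knb; apply: (@nproj_eq_homog (a (+) b)).
  + by apply: nhomog_scale; exact: nhomog_gen.
  + exact: nhomog_gen.
  + exact: nrel_genZr.
- move=> a b m m' n ma ma' nb mma; apply: (@nproj_eq_homog (a (+) b)).
  + exact: nhomog_gen.
  + by apply: nhomog_add; exact: nhomog_gen.
  + exact: nrel_genDl.
- move=> a b m n n' ma nb nb' nnb; apply: (@nproj_eq_homog (a (+) b)).
  + exact: nhomog_gen.
  + by apply: nhomog_add; exact: nhomog_gen.
  + exact: nrel_genDr.
- move=> a a' b m m' n ma ma' mm' nb m'n mn.
  apply: (@nproj_eq_homog ((a (+) a') (+) b)).
  + exact: nhomog_gen.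
  + apply: nhomog_add; first by rewrite -addbA; exact: nhomog_gen.
    do 2 apply: nhomog_scale.
    by rewrite addbAC -addbA [b (+) a']addbC addbCA; exact: nhomog_gen.
  + exact: nrel_gen_bracketl.
- move=> a b b' m n n' ma nb nb' nn' n'm nm.
  apply: (@nproj_eq_homog (a (+) (b (+) b'))).
  + exact: nhomog_gen.
  + apply: nhomog_add.
      apply: nhomog_scale; apply: nhomog_eq (nhomog_gen _ _) _.
      by case: a b b' {ma nb nb' nn' n'm nm} => [] [] [].
    do 2 apply: nhomog_scale; apply: nhomog_eq (nhomog_gen _ _) _.
    by case: a b b' {ma nb nb' nn' n'm nm} => [] [] [].
  + exact: nrel_gen_bracketr.
- move=> a b a' b' m n m' n' ma nb ma' nb' nm m'n'.
  apply: (@nproj_eq_homog ((a (+) b) (+) (a' (+) b'))).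
  + by apply: nhomog_bracket; exact: nhomog_gen.
  + do 2 apply: nhomog_scale; rewrite [a (+) b]addbC; exact: nhomog_gen.
  + exact: nrel_gen_gen.
Qed.

Let gr_proj d (x : natensor) := nproj d (rep x).

Let gr_projE d s : gr_proj d (ncls s) = nproj d s.
Proof.
exact: (lift_cls (P := natensor_presentation) (fun _ _ h => nproj_nrel h d)).
Qed.

Lemma natensor_direct_sum : internal_direct_sum natensor_grade.
Proof.
apply: (@internal_direct_sum_proj _ _ _ gr_proj) => [|d x|x|d x].
- exact: natensor_grade_closed.
- elim/ncls_ind: x => s; rewrite gr_projE.
  elim: s d => [a b m n ma nb||s hs t ht|k s hs|s hs t ht] d /=.
  + case: eqP => [<-|_]; last by have [] := natensor_grade_closed d.
    by apply/natensor_gradeP; eexists; first exact: (nhomog_gen ma nb).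
  + by have [] := natensor_grade_closed d.
  + case/natensor_gradeP: (hs d) => u ud ->.
    case/natensor_gradeP: (ht d) => v vd ->.
    by apply/natensor_gradeP; exists (Nadd u v); rewrite ?nclsD //; exact: nhomog_add.
  + case/natensor_gradeP: (hs d) => u ud ->.
    by apply/natensor_gradeP; exists (Nscale k u); rewrite ?nclsZ //; exact: nhomog_scale.
  + case/natensor_gradeP: (hs false) => u ud ->.
    case/natensor_gradeP: (ht d) => v vd ->.
    case/natensor_gradeP: (hs true) => u' ud' ->.
    case/natensor_gradeP: (ht (~~ d)) => v' vd' ->.
    rewrite !nbracketE -nclsD; apply/natensor_gradeP; eexists; last by [].
    apply: nhomog_add; first exact: (nhomog_bracket ud vd).
    by apply: nhomog_eq (nhomog_bracket ud' vd') _; rewrite addTb negbK.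
- elim/ncls_ind: x => s; rewrite !gr_projE.
  elim: s => [a b m n ma nb||s hs t ht|k s hs|s hs t ht] /=.
  + by case: (a (+) b); rewrite /= ?addr0 ?add0r.
  + by rewrite addr0.
  + by rewrite addrACA hs ht nclsD.
  + by rewrite -scalerDr hs nclsZ.
  + rewrite addrACA -!brDr.
    by rewrite [nproj true t + _]addrC ht -brDl hs nbracketE.
- case/natensor_gradeP => s sd ->; rewrite gr_projE (nproj_homog sd).
  by case: d {sd}.
Qed.

HB.instance Definition _ :=
  isSuperModule.Build K natensor natensor_direct_sum.

Lemma nbracket_grade a b (x y : natensor) : x \in grade a -> y \in grade b ->
  nbracket x y \in grade (a (+) b).
Proof.
move=> /natensor_gradeP[s sa ->] /natensor_gradeP[t tb ->].
apply/natensor_gradeP; exists (Nbracket s t); last exact: nbracketE.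
exact: nhomog_bracket.
Qed.

Lemma nbracket_skew a b (x y : natensor) : x \in grade a -> y \in grade b ->
  nbracket x y = - ((-1) ^+ (a && b) *: nbracket y x).
Proof.
move=> /natensor_gradeP[s sa ->] /natensor_gradeP[t tb ->].
by rewrite !nbracketE -nclsZ -nclsN; apply/nclsP; exact: nrel_skew.
Qed.

Lemma nbracket_jacobi a b c (x y z : natensor) :
  x \in grade a -> y \in grade b -> z \in grade c ->
  nbracket x (nbracket y z) =
    nbracket (nbracket x y) z + (-1) ^+ (a && b) *: nbracket y (nbracket x z).
Proof.
move=> /natensor_gradeP[s sa ->] /natensor_gradeP[t tb ->].
move=> /natensor_gradeP[u uc ->].
rewrite !nbracketE -nclsZ -nclsD; apply/nclsP.
exact: nrel_jacobi sa tb uc.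
Qed.

Lemma nbracket_even (x : natensor) : x \in grade false -> nbracket x x = 0.
Proof.
move=> /natensor_gradeP[s s0 ->]; rewrite nbracketE -ncls0; apply/nclsP.
exact: nrel_even.
Qed.

HB.instance Definition _ := isLieSuperAlgebra.Build K natensor
  nbracket_linearl nbracket_linearr nbracket_grade nbracket_skew
  nbracket_jacobi nbracket_even.

(* The symbol m (x) n, extended bilinearly to arbitrary m and n. *)
Definition natens (m : M) (n : N) : natensor :=
  \sum_(a : bool) \sum_(b : bool)
    ncls (Ngen (component_grade a m) (component_grade b n)).

Lemma ncls_gen_eq a b m m' n n' (ma : m \in grade a) (nb : n \in grade b)
    (ma' : m' \in grade a) (nb' : n' \in grade b) : m = m' -> n = n' ->
  ncls (Ngen ma nb) = ncls (Ngen ma' nb').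
Proof.
move=> mE nE; case: m' / mE ma' => ma'; case: n' / nE nb' => nb'.
by rewrite (bool_irrelevance ma' ma) (bool_irrelevance nb' nb).
Qed.

Lemma ncls_gen0l a b n (ma : 0 \in grade a) (nb : n \in grade b) :
  ncls (Ngen ma nb) = 0.
Proof.
have kma : 0 *: (0 : M) \in grade a by rewrite scaler0.
rewrite (ncls_gen_eq ma nb kma nb) ?scaler0 //.
by rewrite -(scale0r (ncls (Ngen ma nb))) -nclsZ; apply/nclsP/nrel_sym/nrel_genZl.
Qed.

Lemma ncls_gen0r a b m (ma : m \in grade a) (nb : 0 \in grade b) :
  ncls (Ngen ma nb) = 0.
Proof.
have knb : 0 *: (0 : N) \in grade b by rewrite scaler0.
rewrite (ncls_gen_eq ma nb ma knb) ?scaler0 //.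
by rewrite -(scale0r (ncls (Ngen ma nb))) -nclsZ; apply/nclsP/nrel_sym/nrel_genZr.
Qed.

Lemma natens_homog a b m n (ma : m \in grade a) (nb : n \in grade b) :
  natens m n = ncls (Ngen ma nb).
Proof.
have z c d (md : component c m \in grade c) (nd : component d n \in grade d) :
    (c, d) != (a, b) -> ncls (Ngen md nd) = 0.
  move=> cd; have [ca|ca] := eqVneq c a; last first.
    have m0 : component c m = 0.
      by apply: component_neq; rewrite -[~~ c]addTb; case: c a ca ma {md cd} => [] [].
    by rewrite (ncls_gen_eq md nd (grade0 M c) nd m0 erefl) ncls_gen0l.
  have db : d != b by apply: contra cd => /eqP->; rewrite ca.
  have n0 : component d n = 0.
    by apply: component_neq; case: d b db nb {nd cd} => [] [].
  by rewrite (ncls_gen_eq md nd md (grade0 N d) erefl n0) ncls_gen0r.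
rewrite /natens (bigD1 a) //= (bigD1 b) //= !big1 ?addr0.
- by apply: ncls_gen_eq; exact: component_id.
- move=> c ca; rewrite big1 // => d _; apply: z.
  by apply: contra ca => /eqP[->].
- by move=> d db; apply: z; apply: contra db => /eqP[->].
Qed.

End NonAbelianTensor.

(* Main.v *)
From HB Require Import structures.
Require Import Defs.
From mathcomp Require Import all_boot all_algebra.

(** By relation (iv) the bracket of two symbols is again a multiple of a
    symbol, so the symbols span the non-abelian tensor product linearly; this
    is the surjectivity. When the actions are trivial, (iv) kills every bracket
    and (iii) kills the symbols with a bracket as an argument, so the symbols
    and the pure tensors over the abelianizations satisfy the same relations,
    whence two mutually inverse maps. *)

Set Implicit Arguments.
Unset Strict Implicit.
Unset Printing Implicit Defensive.

Import GRing.Theory.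

Local Open Scope ring_scope.

(** * Linear maps on spans, homogeneous elements, zero tensors *)

(** Used to pass to the quotients by [[M, M]] and [[N, N]]. Linearity is a hypothesis, so that [h]
    may be a bilinear map with one argument fixed. *)
Lemma linear_span0 {K : comPzRingType} {U V : lmodType K} (h : U -> V)
    (X : U -> Prop) :
  linear h -> (forall x, X x -> h x = 0) -> forall x, Defs.span X x -> h x = 0.
Proof.
move=> hl hX x.
have h0 : h 0 = 0.
  by have := hl (-1) 0 0; rewrite scaleN1r oppr0 addr0 scaleN1r addNr.
elim=> {x} [x /hX //|//|x y _ hx _ hy|k x _ hx].
  by have := hl 1 x y; rewrite !scale1r hx hy addr0.
by have := hl k x 0; rewrite !addr0 h0 hx scaler0 addr0.
Qed.

(** The defining relations concern homogeneous elements only; this extends their consequences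
    additively to all elements. *)
Lemma homog_ind (K : comPzRingType) (V : superModType K) (Q : V -> Prop) :
    (forall a x, x \in grade a -> Q x) ->
  (forall x y, Q x -> Q y -> Q (x + y)) -> forall x, Q x.
Proof.
move=> Qh QD x; have [_ /(_ x)[x0 [x1 [h0 h1 ->]]] _] := @gradeP K V.
by apply: QD; [exact: Qh h0 | exact: Qh h1].
Qed.

Section Tens0.
Context {K : comPzRingType} {M N : superModType K}.

Lemma tens0l (n : N) : tens (0 : M) n = 0.
Proof. by rewrite -(scale0r (0 : M)) tensZl scale0r. Qed.

Lemma tens0r (m : M) : tens m (0 : N) = 0.
Proof. by rewrite -(scale0r (0 : N)) tensZr scale0r. Qed.

End Tens0.

Lemma to_ab_bracket {K : comPzRingType} {M : lieSuperAlgType K} (x y : M) :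
  to_ab (bracket x y) = 0.
Proof.
rewrite -(linear0 (@to_ab K M)); apply/to_abP; rewrite subr0.
by apply: span_mem; exists x, y.
Qed.

(** * Bilinearity of the symbols and their linear span *)

Section NonAbelianTensorTheory.
Context {K : comPzRingType} {M N : lieSuperAlgType K}.
Variables (f : superAction M N) (g : superAction N M).

Lemma natens_linearl n : linear ((natens f g)^~ n).
Proof.
move=> k x y; rewrite /natens scaler_sumr -big_split; apply: eq_bigr => a _ /=.
rewrite scaler_sumr -big_split; apply: eq_bigr => b _ /=.
have kxa := gradeZ k (component_grade a x).
have kxya := gradeD kxa (component_grade a y).
(* The component of [k *: x + y] is replaced by the combination of components, along with its
   homogeneity proof, so that relations (i) and (ii) apply. *)
rewrite (ncls_gen_eq f g _ _ kxya (component_grade b n)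
  (component_linear a k x y) erefl).
rewrite -nclsZ -nclsD; apply/nclsP.
apply: nrel_trans (nrel_genDl _ _ kxa (component_grade a y) _ _) _.
by apply: nrel_add; [apply/nrel_sym/nrel_genZl | exact: nrel_refl].
Qed.

Lemma natens_linearr m : linear (natens f g m).
Proof.
move=> k x y; rewrite /natens scaler_sumr -big_split; apply: eq_bigr => a _ /=.
rewrite scaler_sumr -big_split; apply: eq_bigr => b _ /=.
have kxb := gradeZ k (component_grade b x).
have kxyb := gradeD kxb (component_grade b y).
rewrite (ncls_gen_eq f g _ _ (component_grade a m) kxyb
  erefl (component_linear b k x y)).
rewrite -nclsZ -nclsD; apply/nclsP.
apply: nrel_trans (nrel_genDr _ _ _ kxb (component_grade b y) _) _.
by apply: nrel_add; [apply/nrel_sym/nrel_genZr | exact: nrel_refl].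
Qed.

Lemma natens_grade a b m n : m \in grade a -> n \in grade b ->
  natens f g m n \in grade (a (+) b).
Proof.
move=> ma nb; rewrite (natens_homog _ _ ma nb).
by apply/natensor_gradeP; exists (Ngen ma nb); first exact: nhomog_gen.
Qed.

Definition homog_symbol (x : natensor f g) : Prop :=
  exists a b m n, [/\ m \in grade a, n \in grade b & x = natens f g m n].

Lemma bracket_natens a b a' b' m n m' n' :
  m \in grade a -> n \in grade b -> m' \in grade a' -> n' \in grade b' ->
  bracket (natens f g m n) (natens f g m' n') =
  - ((-1) ^+ (a && b) *: natens f g (g n m) (f m' n')).
Proof.
move=> ma nb ma' nb'; have nm := act_grade g nb ma.
have mn := act_grade f ma' nb'.
rewrite (natens_homog _ _ ma nb) (natens_homog _ _ ma' nb').
rewrite (natens_homog _ _ nm mn) [LHS]nbracketE -nclsZ -nclsN; apply/nclsP.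
exact: nrel_gen_gen.
Qed.

(** Bilinearity reduces the claim to generators. It serves with [Y] the symbols, for spanning, and
    with [Y] only zero, for commutativity. *)
Lemma bracket_span (L : lieSuperAlgType K) (X Y : L -> Prop) :
    (forall x y, X x -> X y -> Defs.span Y (bracket x y)) ->
  forall x y, Defs.span X x -> Defs.span X y -> Defs.span Y (bracket x y).
Proof.
move=> XY x y Xx; elim=> {y} [y Xy||y z _ hy _ hz|k y _ hy].
- elim: Xx => {x} [x Xx||x z _ hx _ hz|k x _ hx]; first exact: XY.
  + by rewrite bracket0l; exact: span0.
  + by rewrite bracketDl; exact: spanD.
  + by rewrite bracketZl; exact: spanZ.
- by rewrite bracket0r; exact: span0.
- by rewrite bracketDr; exact: spanD.
- by rewrite bracketZr; exact: spanZ.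
Qed.

(** Induction on terms; only the bracket case is not immediate, and there (iv) turns a bracket of
    symbols into a multiple of a symbol. *)
Lemma natensor_span (x : natensor f g) : Defs.span homog_symbol x.
Proof.
elim/ncls_ind: x; elim=> [a b m n ma nb||s hs t ht|k s hs|s hs t ht].
- by rewrite -natens_homog; apply: span_mem; exists a, b, m, n.
- by rewrite ncls0; exact: span0.
- by rewrite nclsD; exact: spanD.
- by rewrite nclsZ; exact: spanZ.
- rewrite -nbracketE; apply: bracket_span hs ht => x y.
  move=> [a [b [m [n [ma nb ->]]]]] [a' [b' [m' [n' [ma' nb' ->]]]]].
  rewrite (bracket_natens ma nb ma' nb') -scaleN1r; do 2 apply: spanZ.
  apply: span_mem; exists (b (+) a), (a' (+) b'), (g n m), (f m' n').
  by split=> //; exact: act_grade.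
Qed.

(** * The canonical map *)

Definition tensor_to_natensor : tensor M N -> natensor f g :=
  tensor_lift (natens f g).

Lemma tensor_to_natensor_linear : linear tensor_to_natensor.
Proof. exact: tensor_lift_linear natens_linearl natens_linearr. Qed.

HB.instance Definition _ := GRing.isLinear.Build K (tensor M N) (natensor f g)
  *:%R tensor_to_natensor tensor_to_natensor_linear.

Lemma tensor_to_natensor_tens m n :
  tensor_to_natensor (tens m n) = natens f g m n.
Proof. exact: tensor_lift_tens natens_linearl natens_linearr m n. Qed.

Lemma tensor_to_natensor_even : is_even tensor_to_natensor.
Proof.
move=> d x /tensor_gradeP; elim=> {x} [x||x y _ hx _ hy|k x _ hx].
- move=> [a [b [m [n [<- ma nb ->]]]]].
  by rewrite tensor_to_natensor_tens; exact: natens_grade.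
- by rewrite linear0 grade0.
- by rewrite linearD gradeD.
- by rewrite linearZ gradeZ.
Qed.

(** The image is a submodule containing the symbols, which span. *)
Lemma tensor_to_natensor_surj y : exists x, tensor_to_natensor x = y.
Proof.
elim: (natensor_span y) => {y} [y||x y _ [u <-] _ [v <-]|k x _ [u <-]].
- move=> [a [b [m [n [_ _ ->]]]]]; exists (tens m n).
  exact: tensor_to_natensor_tens.
- by exists 0; rewrite linear0.
- by exists (u + v); rewrite linearD.
- by exists (k *: u); rewrite linearZ.
Qed.

Lemma natens0l n : natens f g 0 n = 0.
Proof. by rewrite -tensor_to_natensor_tens tens0l linear0. Qed.

Lemma natens0r m : natens f g m 0 = 0.
Proof. by rewrite -tensor_to_natensor_tens tens0r linear0. Qed.

(** * Trivial actions: vanishing of brackets *)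

Hypotheses (f0 : acts_trivially f) (g0 : acts_trivially g).

Lemma natensor_abelian : is_abelian (natensor f g).
Proof.
move=> x y.
(* By (iv), a bracket of symbols is a multiple of a symbol whose second argument is a value of the
   action [f], hence zero. *)
have : Defs.span (fun z : natensor f g => z = 0) (bracket x y).
  apply: bracket_span (natensor_span x) (natensor_span y) => {x y} x y.
  move=> [a [b [m [n [ma nb ->]]]]] [a' [b' [m' [n' [ma' nb' ->]]]]].
  rewrite (bracket_natens ma nb ma' nb') f0 natens0r scaler0 oppr0.
  exact: span0.
exact: (linear_span0 (h := id)).
Qed.

(** For homogeneous arguments, both terms on the right of the first relation in (iii) contain a
    value of the action [f]. *)
Lemma natens_bracketl m m' n : natens f g (bracket m m') n = 0.
Proof.
(* Written through the canonical map, the symbol is additive in each argument by [linearD]. *)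
rewrite -tensor_to_natensor_tens.
elim/homog_ind: m => [a m ma|x y hx hy]; last first.
  by rewrite bracketDl tensDl linearD /= hx hy addr0.
elim/homog_ind: m' => [b m' mb|x y hx hy]; last first.
  by rewrite bracketDr tensDl linearD /= hx hy addr0.
elim/homog_ind: n => [c n nc|x y hx hy]; last first.
  by rewrite tensDr linearD /= hx hy addr0.
have mm := bracket_grade _ _ _ _ ma mb.
have fb := act_grade f mb nc; have fa := act_grade f ma nc.
rewrite tensor_to_natensor_tens (natens_homog _ _ mm nc).
have /nclsP -> := @nrel_gen_bracketl K M N f g _ _ _ _ _ _ ma mb mm nc fb fa.
rewrite nclsD nclsN nclsZ -!natens_homog !f0 !natens0r.
by rewrite scaler0 oppr0 addr0.
Qed.

Lemma natens_bracketr m n n' : natens f g m (bracket n n') = 0.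
Proof.
rewrite -tensor_to_natensor_tens.
elim/homog_ind: m => [a m ma|x y hx hy]; last first.
  by rewrite tensDl linearD /= hx hy addr0.
elim/homog_ind: n => [b n nb|x y hx hy]; last first.
  by rewrite bracketDl tensDr linearD /= hx hy addr0.
elim/homog_ind: n' => [c n' nc|x y hx hy]; last first.
  by rewrite bracketDr tensDr linearD /= hx hy addr0.
have nn := bracket_grade _ _ _ _ nb nc.
have gb := act_grade g nb ma; have gc := act_grade g nc ma.
rewrite tensor_to_natensor_tens (natens_homog _ _ ma nn).
have /nclsP -> := @nrel_gen_bracketr K M N f g _ _ _ _ _ _ ma nb nc nn gc gb.
rewrite nclsD nclsN !nclsZ -!natens_homog !g0 !natens0l.
by rewrite !scaler0 oppr0 addr0.
Qed.

(** * The map from the tensor product of the abelianizations *)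

Definition ab_natens (x : abelianization M) (y : abelianization N) :
    natensor f g :=
  natens f g (rep x) (rep y).

(** Independence of the representatives: two of them differ by an element of the span of brackets,
    on which the symbol vanishes in either argument. *)
Lemma ab_natensE m n : ab_natens (to_ab m) (to_ab n) = natens f g m n.
Proof.
have hl n1 : natens f g (rep (to_ab m)) n1 = natens f g m n1.
  have : Defs.span (@is_bracket K M) (rep (to_ab m) - m).
    exact: (rep_cls (P := quotient_presentation (@is_bracket K M))).
  move/(linear_span0 (natens_linearl n1)) => h; apply/eqP; rewrite -subr_eq0.
  (* The difference of two symbols becomes a single symbol in [rep (to_ab m) - m], to which [h]
     applies. *)
  rewrite -!tensor_to_natensor_tens -linearB /= -scaleN1r -tensZl -tensDl.
  rewrite scaleN1r tensor_to_natensor_tens h // => _ [x [y ->]].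
  exact: natens_bracketl.
have : Defs.span (@is_bracket K N) (rep (to_ab n) - n).
  exact: (rep_cls (P := quotient_presentation (@is_bracket K N))).
rewrite /ab_natens hl.
move/(linear_span0 (natens_linearr m)) => h; apply/eqP; rewrite -subr_eq0.
rewrite -!tensor_to_natensor_tens -linearB /= -scaleN1r -tensZr -tensDr.
rewrite scaleN1r tensor_to_natensor_tens h // => _ [x [y ->]].
exact: natens_bracketr.
Qed.

Lemma ab_natens_linearl y : linear (ab_natens^~ y).
Proof.
move=> k; elim/to_ab_ind: y => n; elim/to_ab_ind=> m; elim/to_ab_ind=> m'.
by rewrite -linearP !ab_natensE natens_linearl.
Qed.

Lemma ab_natens_linearr x : linear (ab_natens x).
Proof.
move=> k; elim/to_ab_ind: x => m; elim/to_ab_ind=> n; elim/to_ab_ind=> n'.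
by rewrite -linearP !ab_natensE natens_linearr.
Qed.

Local Notation ab_tensor := (tensor (abelianization M) (abelianization N)).

Definition ab_tensor_to_natensor : ab_tensor -> natensor f g :=
  tensor_lift ab_natens.

Lemma ab_tensor_to_natensor_linear : linear ab_tensor_to_natensor.
Proof. exact: tensor_lift_linear ab_natens_linearl ab_natens_linearr. Qed.

HB.instance Definition _ := GRing.isLinear.Build K ab_tensor (natensor f g)
  *:%R ab_tensor_to_natensor ab_tensor_to_natensor_linear.

Lemma ab_tensor_to_natensor_tens m n :
  ab_tensor_to_natensor (tens (to_ab m) (to_ab n)) = natens f g m n.
Proof.
rewrite -ab_natensE.
exact: tensor_lift_tens ab_natens_linearl ab_natens_linearr _ _.
Qed.

(** * The map to the tensor product of the abelianizations and its inverse *)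

(** The target is regarded as an abelian Lie superalgebra, so bracket terms go to zero. *)
Fixpoint ab_eval (s : nterm M N) : ab_tensor :=
  match s with
  | Ngen _ _ m n _ _ => tens (to_ab m) (to_ab n)
  | Nzero => 0
  | Nadd s t => ab_eval s + ab_eval t
  | Nscale k s => k *: ab_eval s
  | Nbracket _ _ => 0
  end.

Lemma ab_evalP s t : nrel f g s t -> ab_eval s = ab_eval t.
Proof.
elim=> {s t} //=.
- by move=> s t u _ -> _ ->.
- by move=> s s' t t' _ -> _ ->.
- by move=> k s s' _ ->.
- by move=> s t u; rewrite addrA.
- by move=> s t; rewrite addrC.
- by move=> s; rewrite add0r.
- by move=> k l s; rewrite scalerA.
- by move=> s; rewrite scale0r.
- by move=> s; rewrite scale1r.
- by move=> k s t; rewrite scalerDr.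
- by move=> k l s; rewrite scalerDl.
(* Lie axioms: all brackets evaluate to zero. *)
- by rewrite addr0.
- by rewrite addr0.
- by move=> k; rewrite scaler0.
- by move=> k; rewrite scaler0.
- by move=> *; rewrite !scaler0.
- by move=> *; rewrite !scaler0 addr0.
- by move=> *; rewrite linearZ tensZl.
- by move=> *; rewrite linearZ tensZr.
- by move=> *; rewrite linearD tensDl.
- by move=> *; rewrite linearD tensDr.
(* Relations (iii) and (iv): [to_ab] kills the brackets in (iii), a bracket term in (iv) evaluates
   to zero, and the trivial actions kill the other sides. *)
- by move=> *; rewrite to_ab_bracket !f0 !linear0 tens0l !tens0r !scaler0 addr0.
- by move=> *; rewrite to_ab_bracket !g0 !linear0 !tens0l tens0r !scaler0 addr0.
- by move=> *; rewrite f0 linear0 tens0r !scaler0.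
Qed.

Definition natensor_to_ab_tensor (x : natensor f g) : ab_tensor :=
  ab_eval (rep x).

Lemma natensor_to_ab_tensorE s :
  natensor_to_ab_tensor (ncls f g s) = ab_eval s.
Proof. exact: (lift_cls (P := natensor_presentation f g) ab_evalP). Qed.

Lemma natensor_to_ab_tensor_linear : linear natensor_to_ab_tensor.
Proof.
move=> k; elim/ncls_ind=> s; elim/ncls_ind=> t.
by rewrite -nclsZ -nclsD !natensor_to_ab_tensorE.
Qed.

HB.instance Definition _ := GRing.isLinear.Build K (natensor f g) ab_tensor
  *:%R natensor_to_ab_tensor natensor_to_ab_tensor_linear.

(** Immediate from [ab_eval] only for homogeneous arguments, since [natens] is in general a sum over
    components; additivity gives the rest. *)
Lemma natensor_to_ab_tensor_natens m n :
  natensor_to_ab_tensor (natens f g m n) = tens (to_ab m) (to_ab n).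
Proof.
rewrite -tensor_to_natensor_tens.
elim/homog_ind: m => [a m ma|x y hx hy]; last first.
  by rewrite tensDl !linearD /= hx hy tensDl.
elim/homog_ind: n => [b n nb|x y hx hy]; last first.
  by rewrite tensDr !linearD /= hx hy tensDr.
rewrite tensor_to_natensor_tens (natens_homog _ _ ma nb).
exact: natensor_to_ab_tensorE.
Qed.

Lemma natensor_to_ab_tensor_even : is_even natensor_to_ab_tensor.
Proof.
move=> d x /natensor_gradeP[s sd ->]; rewrite natensor_to_ab_tensorE.
(* The bracket case holds because zero has every degree. *)
elim: sd => {d s} [a b m n ma nb|a|a s t _ hs _ ht|a k s _ hs|a b s t _ _ _ _] /=.
- apply: tens_grade; apply/ab_gradeP; [by exists m | by exists n].
- exact: grade0.
- exact: gradeD.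
- exact: gradeZ.
- exact: grade0.
Qed.

(** By linearity it suffices to compare on generators: the symbols on one side, and on the other the
    pure tensors, whose factors are all classes of elements of [M] and [N]. *)
Lemma natensor_to_ab_tensor_bij : bijective natensor_to_ab_tensor.
Proof.
exists ab_tensor_to_natensor => x.
- elim: (natensor_span x) => {x} [x||x y _ hx _ hy|k x _ hx].
  + move=> [a [b [m [n [_ _ ->]]]]].
    by rewrite natensor_to_ab_tensor_natens ab_tensor_to_natensor_tens.
  + by rewrite !linear0.
  + by rewrite !linearD /= hx hy.
  + by rewrite !linearZ /= hx.
- elim/tensor_ind: x => [|x y hx hy|k x hx|x y].
  + by rewrite !linear0.
  + by rewrite !linearD /= hx hy.
  + by rewrite !linearZ /= hx.
  + elim/to_ab_ind: x => m; elim/to_ab_ind: y => n.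
    by rewrite ab_tensor_to_natensor_tens natensor_to_ab_tensor_natens.
Qed.

Lemma natensor_ab_iso : supermodule_iso (natensor f g) ab_tensor.
Proof.
exists natensor_to_ab_tensor; split; first exact: natensor_to_ab_tensor_even.
exact: natensor_to_ab_tensor_bij.
Qed.

End NonAbelianTensorTheory.

Theorem proposition3p5 (K : comPzRingType) (M N : lieSuperAlgType K)
    (f : superAction M N) (g : superAction N M) :
  (exists phi : {linear tensor M N -> natensor f g},
    [/\ forall (m : M) (n : N), phi (tens m n) = natens f g m n,
        is_even phi
      & forall y : natensor f g, exists x : tensor M N, phi x = y]) /\
  (acts_trivially f -> acts_trivially g ->
    is_abelian (natensor f g) /\
    supermodule_iso (natensor f g)
      (tensor (abelianization M) (abelianization N))).
Proof.
split; first exists (tensor_to_natensor f g).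
  split; [exact: tensor_to_natensor_tens | exact: tensor_to_natensor_even
        | exact: tensor_to_natensor_surj].
by move=> f0 g0; split; [exact: natensor_abelian | exact: natensor_ab_iso].
Qed.
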